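(* Let $(X,T)$ be a transitive topological dynamical system. Then $(X,T)$ is weak Banach mean equicontinuous if and only if $(X,T)$ is weak mean equicontinuous.
   Context: A topological dynamical system $(X,T)$ is a compact metric space $X$ with metric $d$ together with a continuous map $T:X\to X$. Transitive means topologically transitive in the usual sense: for all nonempty open $U,V\subset X$ there is $n\ge 0$ with $U\cap T^{-n}V\neq\emptyset$. For integers $0\le m<n$, $S_{n,m}$ is the group of permutations of $\{m,m+1,\dots,n-1\}$, and $S_n$ is the group of permutations of $\{1,\dots,n\}$. For a real family $(a_{m,n})_{0\le m<n}$, $\limsup_{n-m\to+\infty}a_{m,n}=\lim_{N\to\infty}\sup\{a_{m,n}: n-m\ge N\}$. Define $$\overline{BF}(x,y)=\limsup_{n-m\to+\infty}\ \inf_{\sigma\in S_{n,m}}\frac1{n-m}\sum_{k=m}^{n-1}d(T^kx,T^{\sigma(k)}y),\qquad \overline{F}(x,y)=\limsup_{n\to+\infty}\ \inf_{\sigma\in S_n}\frac1n\sum_{k=1}^{n}d(T^kx,T^{\sigma(k)}y).$$ $(X,T)$ is weak Banach mean equicontinuous if for every $x\in X$ and every $\varepsilon>0$ there is $\delta>0$ such that $d(x,y)<\delta$ implies $\overline{BF}(x,y)<\varepsilon$. $(X,T)$ is weak mean equicontinuous if for every $x\in X$ and every $\varepsilon>0$ there is $\delta>0$ such that $d(x,y)<\delta$ implies $\overline{F}(x,y)<\varepsilon$. *)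

(* Defs.v *)
From HB Require Import structures.
From mathcomp Require Import all_boot all_order all_algebra all_fingroup.
From mathcomp Require Import all_classical all_reals all_analysis.

Set Implicit Arguments.
Unset Strict Implicit.
Unset Printing Implicit Defensive.

Import Order.TTheory GRing.Theory Num.Theory.

Local Open Scope classical_set_scope.
Local Open Scope ring_scope.

Section dynamics.
Context {R : realType} {X : metricType R}.
Implicit Types (T : X -> X) (x y : X) (m n : nat).

Definition topologically_transitive T : Prop :=
  forall U V : set X, open U -> open V -> U !=set0 -> V !=set0 ->
    exists n : nat, (U `&` iter n T @^-1` V) !=set0.

(* The permutations of {m, ..., n - 1} are represented as the permutations of
   'I_n = {0, ..., n - 1} that fix every i < m. *)
Definition interval_perm m n : {set 'S_n} := Sym [set i : 'I_n | (m <= i)%N]%SET.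

Definition orbit_mean T x y m n (s : 'S_n) : R :=
  (n - m)%:R^-1 * \sum_(k < n | (m <= k)%N) mdist (iter k T x) (iter (s k) T y).

Definition orbit_matching T x y m n : R :=
  inf [set orbit_mean T x y m s | s in [set` interval_perm m n]].

(* The limits superior are taken in \bar R, so that no boundedness of the
   distance is needed for them to be meaningful. *)
Definition limsup_length (a : nat -> nat -> R) : \bar R :=
  limn (fun N : nat => ereal_sup
    [set (a mn.1 mn.2)%:E | mn in
       [set mn : nat * nat | (mn.1 < mn.2)%N /\ (N <= mn.2 - mn.1)%N]]).

Definition BFbar T x y : \bar R := limsup_length (orbit_matching T x y).

(* {1, ..., n} is the interval {m, ..., n' - 1} with m = 1 and n' = n + 1. *)
Definition Fbar T x y : \bar R :=
  limn_esup (fun n : nat => (orbit_matching T x y 1 n.+1)%:E).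

Definition weak_Banach_mean_equicontinuous T : Prop :=
  forall (x : X) (e : R), 0 < e -> exists2 delta : R, 0 < delta &
    forall y : X, mdist x y < delta -> (BFbar T x y < e%:E)%E.

Definition weak_mean_equicontinuous T : Prop :=
  forall (x : X) (e : R), 0 < e -> exists2 delta : R, 0 < delta &
    forall y : X, mdist x y < delta -> (Fbar T x y < e%:E)%E.

End dynamics.

(* Main.v *)
(* Let D_n(x, y) be the optimal matching cost of the orbit pieces of x and y over
   {1, ..., n}. It is a pseudometric, and D_n(x, T^q x) -> 0 since the two pieces
   are shifts of each other. If T is transitive and weak mean equicontinuous, then
   given x and y there is z near x with T^q z near y, so that D_n(x, y) -> 0 for
   all x and y.
   Hence every pair (x, y) has some l with D_l(x, y) < e. This is an open
   condition, so by compactness of X * X the lengths l can be bounded by a single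
   L. Any long window can then be chopped greedily into blocks of length at most L
   on each of which the cost is less than e, which bounds the cost of all long
   windows uniformly. *)
Require Import Defs.
From mathcomp Require Import all_boot all_order all_algebra all_fingroup.
From mathcomp Require Import all_classical all_reals all_analysis.
From mathcomp Require Import zify ring lra.

Set Implicit Arguments.
Unset Strict Implicit.
Unset Printing Implicit Defensive.

Import Order.TTheory GRing.Theory Num.Theory.

Local Open Scope classical_set_scope.
Local Open Scope ring_scope.

(** * Matchings of two sequences over a window of times *)

Section matched.
Context {R : realType} {X : metricType R}.
Implicit Types (u v w : nat -> X) (a b c n : nat) (r : R).

Definition window n a b : {set 'I_n} := [set i : 'I_n | (a <= i < b)%N]%SET.

(** The cost is a sum rather than a mean, so that costs add when windows are concatenated. Arbitrary
    sequences instead of orbits make time shifts expressible; the ambient [n] is only room for the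
    window. *)
Definition matched n u v a b r : Prop :=
  exists2 s : 'S_n, perm_on (window n a b) s &
    \sum_(k < n | (a <= k < b)%N) mdist (u k) (v (s k)) <= r.

Lemma perm_on_window n a b (s : 'S_n) (k : 'I_n) :
  perm_on (window n a b) s -> (a <= s k < b)%N = (a <= k < b)%N.
Proof. by move=> /(perm_closed k); rewrite !inE. Qed.

Lemma matched_le n u v a b r r' :
  r <= r' -> matched n u v a b r -> matched n u v a b r'.
Proof. by move=> rr' [s s_on sr]; exists s => //; exact: le_trans rr'. Qed.

Lemma matched_sym n u v a b r : matched n u v a b r -> matched n v u a b r.
Proof.
move=> [s s_on sr]; exists s^-1%g; first exact: perm_onV.
rewrite (reindex_inj (@perm_inj _ s)) /=.
under eq_bigl do rewrite perm_on_window//.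
by under eq_bigr do rewrite permK metric_sym.
Qed.

(** The triangle inequality through [v (s k)], with the second sum reindexed by [s]. *)
Lemma matched_trans n u v w a b r r' :
  matched n u v a b r -> matched n v w a b r' -> matched n u w a b (r + r').
Proof.
move=> [s s_on sr] [t t_on tr]; exists (s * t)%g; first exact: perm_onM.
apply: (le_trans _ (lerD sr tr)).
rewrite [X in _ <= _ + X](reindex_inj (@perm_inj _ s)) /=.
under [X in _ <= _ + X]eq_bigl do rewrite perm_on_window//.
rewrite -big_split/=; apply: ler_sum => k _.
by rewrite permM; exact: metric_triangle.
Qed.

(** The two permutations have disjoint supports, so their product acts as [s] on the first window
    and as [t] on the second. *)
Lemma matched_cat n u v a b c r r' : (a <= b <= c)%N ->
  matched n u v a b r -> matched n u v b c r' -> matched n u v a c (r + r').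
Proof.
move=> abc [s s_on sr] [t t_on tr]; exists (s * t)%g.
  apply: perm_onM.
    by apply: (fintype.subset_trans s_on); apply/fintype.subsetP => i;
      rewrite !inE; lia.
  by apply: (fintype.subset_trans t_on); apply/fintype.subsetP => i;
      rewrite !inE; lia.
apply: (le_trans _ (lerD sr tr)).
rewrite (bigID (fun k : 'I_n => (k < b)%N))/=; apply: lerD.
  rewrite le_eqVlt; apply/orP; left; apply/eqP.
  apply: eq_big => [k|k kP]; first by lia.
  rewrite permM (out_perm t_on)// inE.
  by have := perm_on_window k s_on; lia.
rewrite le_eqVlt; apply/orP; left; apply/eqP.
apply: eq_big => [k|k kP]; first by lia.
by rewrite permM (out_perm s_on)// inE; lia.
Qed.

(** Lets a matching be given by a plain function on times: extended by the identity outside the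
    window, it becomes a permutation of ['I_n]. *)
Lemma matched_fun n u v a b (f : nat -> nat) : (b <= n)%N ->
  (forall k, (a <= k < b)%N -> (a <= f k < b)%N) ->
  (forall k l, (a <= k < b)%N -> (a <= l < b)%N -> f k = f l -> k = l) ->
  matched n u v a b (\sum_(a <= k < b) mdist (u k) (v (f k))).
Proof.
(* [inord] needs a nonempty ordinal type. *)
move=> bn fab f_inj; case: n bn => [|n] bn.
  exists 1%g; first exact: perm_on1.
  by rewrite big_ord0; apply: sumr_ge0 => k _; exact: mdist_ge0.
pose g (k : 'I_n.+1) : 'I_n.+1 := if (a <= k < b)%N then inord (f k) else k.
have gE (k : 'I_n.+1) : (a <= k < b)%N -> g k = f k :> nat.
  by move=> kab; rewrite /g kab inordK//; have := fab _ kab; lia.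
have gN (k : 'I_n.+1) : (a <= k < b)%N = false -> g k = k.
  by move=> kab; rewrite /g kab.
have g_inj : injective g.
  move=> k l kl; apply: val_inj => /=.
  have := congr1 val kl => /=.
  case: (boolP (a <= k < b)%N) => [kab|/negbTE kab];
    case: (boolP (a <= l < b)%N) => [lab|/negbTE lab].
  - by rewrite !gE//; exact: f_inj.
  - by rewrite gE// gN//; have := fab _ kab; lia.
  - by rewrite gN// gE//; have := fab _ lab; lia.
  - by rewrite !gN.
exists (perm g_inj).
  apply/fintype.subsetP => k; rewrite !inE permE.
  by apply: contraR => /negbTE /gN ->.
rewrite (big_nat_widen _ _ n.+1)// (big_nat_widenl _ 0)// big_mkord.
rewrite le_eqVlt; apply/orP; left; apply/eqP.
apply: eq_big => [k|k kab]; first by lia.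
by rewrite permE gE.
Qed.

Lemma matched_id n u v a b : (b <= n)%N ->
  matched n u v a b (\sum_(a <= k < b) mdist (u k) (v k)).
Proof. by move=> bn; exact: (@matched_fun n u v a b id). Qed.

Lemma matched_bound n u v a b (C : R) : (a <= b <= n)%N ->
  (forall k, (a <= k < b)%N -> mdist (u k) (v k) <= C) ->
  matched n u v a b ((b - a)%:R * C).
Proof.
move=> abn uvC; apply: matched_le (matched_id _ _ _ _); last by lia.
by rewrite mulr_natl -sumr_const_nat; exact: ler_sum_nat.
Qed.

(** Serves to put a block matched near time 0 in its place inside a long window; the ambient size
    changes too, so the permutation is rebuilt from [f]. *)
Lemma matched_shift n p j u v a b r : (b <= n)%N -> (b + j <= p)%N ->
  matched n (fun k => u (k + j)%N) (fun k => v (k + j)%N) a b r ->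
  matched p u v (a + j)%N (b + j)%N r.
Proof.
move=> bn bjp [s s_on sr]; case: n bn s s_on sr => [|n] bn s s_on sr.
  have b0 : b = 0%N by lia.
  apply: matched_le (matched_id _ _ _ bjp); apply: le_trans sr.
  by rewrite big_ord0 big_geq// b0; lia.
pose f k := (s (inord (k - j)) + j)%N.
apply: matched_le (matched_fun (f := f) _ _ bjp _ _).
- apply: (le_trans _ sr); rewrite big_addn addnK.
  rewrite (big_nat_widen _ _ n.+1)// (big_nat_widenl _ 0)// big_mkord.
  rewrite le_eqVlt; apply/orP; left; apply/eqP.
  apply: eq_big => [k|k kab]; first by lia.
  by rewrite /f addnK inord_val.
- move=> k kab; have := perm_on_window (inord (k - j)) s_on.
  by rewrite /f inordK; lia.
- move=> k l kab lab /addIn/val_inj/perm_inj/(congr1 val) /=.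
  by rewrite !inordK; lia.
Qed.

(* Match [k] with [k - 1]; only the wrapped pair [(a, b - 1)] costs anything. *)
Lemma matched_succ n u v a b : (a < b <= n)%N -> (forall k, v k = u k.+1) ->
  matched n u v a b (mdist (u a) (u b)).
Proof.
move=> abn vu; pose f k := if k == a then b.-1 else k.-1.
apply: matched_le (matched_fun (f := f) _ _ _ _ _); last 3 first.
- by lia.
- by move=> k kab; rewrite /f; case: eqP; lia.
- by move=> k l kab lab; rewrite /f; case: eqP; case: eqP; lia.
rewrite big_ltn; last by lia.
rewrite big_nat big1 ?addr0 => [|k kab].
  by rewrite /f eqxx vu prednK//; lia.
have -> : f k = k.-1 by rewrite /f; case: eqP; lia.
by rewrite vu prednK ?mdistxx//; lia.
Qed.

End matched.

(** * Bounded distances and convergence of the window suprema *)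

Lemma compact_mdist_bounded {R : realType} {X : metricType R} :
  compact [set: X] -> exists C : R, forall x y : X, mdist x y <= C.
Proof.
move=> Xcpt; have /compact_near_coveringP := compact_setX Xcpt Xcpt.
move=> /(_ _ \oo (fun (L : nat) (p : X * X) => mdist p.1 p.2 <= L%:R)).
case=> [[x y] _|L _ LP]; last first.
  by exists L%:R => x y; exact: (LP L (leqnn L) (x, y)).
(* The 2 pays for moving each of the two points within a unit ball. *)
exists (ball x 1 `*` ball y 1, [set L : nat | mdist x y + 2 <= L%:R]).
  split; last exact: nbhs_infty_ger.
  by exists (ball x 1, ball y 1) => //; split; exact: nbhsx_ballx.
move=> [[x' y'] L] /=; rewrite !ballEmdist => -[[/= xx' yy'] xyL].
have := metric_triangle x' x y'; have := metric_triangle x y y'.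
rewrite (metric_sym x' x); lra.
Qed.

Lemma is_cvg_limsup_length {R : realType} (a : nat -> nat -> R) :
  cvgn (fun N : nat => ereal_sup
    [set (a mn.1 mn.2)%:E | mn in
       [set mn : nat * nat | (mn.1 < mn.2)%N /\ (N <= mn.2 - mn.1)%N]]).
Proof.
apply: ereal_nonincreasing_is_cvgn => N N' NN'.
apply: ereal_sup_le => _ [mn [mn_lt Nmn] <-]; exists mn => //.
by split => //; exact: leq_trans Nmn.
Qed.

(** * Matchings of orbit pieces *)

Section orbits.
Context {R : realType} {X : metricType R} (T : X -> X).
Implicit Types (x y z : X) (m n : nat) (e r : R).

Local Notation orb x := (fun k : nat => iter k T x).

Lemma interval_permP m n (s : 'S_n) :
  s \in interval_perm m n <-> perm_on (window n m n) s.
Proof.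
suff -> : window n m n = [set i : 'I_n | (m <= i)%N]%SET by rewrite inE.
by apply/finset.setP => i; rewrite !inE ltn_ord andbT.
Qed.

Lemma orbit_matching_lt x y m n r : (m < n)%N ->
  orbit_matching T x y m n < r ->
  matched n (orb x) (orb y) m n (r * (n - m)%:R).
Proof.
move=> mn /inf_lt[|_ [s /= s_in <-] sr].
  (* The identity shows that the set under the infimum is nonempty. *)
  exists (orbit_mean T x y m (1%g : 'S_n)), 1%g => //=.
have nm0 : (0 : R) < (n - m)%:R by rewrite ltr0n subn_gt0.
exists s; first exact: ((interval_permP m _).1 s_in).
rewrite -ler_pdivrMr// mulrC.
under eq_bigl do rewrite ltn_ord andbT.
exact: ltW.
Qed.

Lemma orbit_matching_le x y m n r : (m < n)%N ->
  matched n (orb x) (orb y) m n r ->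
  orbit_matching T x y m n <= r / (n - m)%:R.
Proof.
move=> mn [s s_on sr].
have nm0 : (0 : R) < (n - m)%:R by rewrite ltr0n subn_gt0.
apply: (@le_trans _ _ (orbit_mean T x y m s)).
  apply: ge_inf; last first.
    exists s => //=; exact: ((interval_permP m _).2 s_on).
  exists 0 => _ [t _ <-]; rewrite mulr_ge0 ?invr_ge0//.
  by apply: sumr_ge0 => k _; exact: mdist_ge0.
rewrite /orbit_mean mulrC ler_pM2r ?invr_gt0//.
by move: sr; under eq_bigl do rewrite ltn_ord andbT.
Qed.

(** The form in which [Fbar T x y < e] is used; chaining through intermediate points adds the
    constants [e]. *)
Definition asymptotically_matched e x y : Prop :=
  \forall n \near \oo, matched n.+1 (orb x) (orb y) 1 n.+1 (e * n%:R).

Lemma asymptotically_matched_sym e x y :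
  asymptotically_matched e x y -> asymptotically_matched e y x.
Proof. by apply: filterS => n; exact: matched_sym. Qed.

Lemma asymptotically_matched_trans e e' x y z :
  asymptotically_matched e x y -> asymptotically_matched e' y z ->
  asymptotically_matched (e + e') x z.
Proof.
move=> xy yz; near=> n; rewrite mulrDl; apply: (@matched_trans _ _ _ _ (orb y)).
  by near: n.
by near: n.
Unshelve. all: by end_near. Qed.

Lemma Fbar_lt_asymptotically_matched e x y :
  (Fbar T x y < e%:E)%E -> asymptotically_matched e x y.
Proof.
(* [limn_esup] is an infimum, over the sets [V] of the filter [\oo], of suprema over [V]. *)
move=> /ereal_inf_lt[_ [V Voo <-] Ve].
near=> n; have /orbit_matching_lt : orbit_matching T x y 1 n.+1 < e.
  rewrite -lte_fin; apply: le_lt_trans Ve.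
  apply: ereal_sup_ubound => /=; exists n => //.
  by near: n.
rewrite subn1; apply; rewrite ltnS; near: n; exact: nbhs_infty_gt.
Unshelve. all: by end_near. Qed.

(** One more application of [T] costs at most [C] in total, however long the window, hence nothing
    on average in the limit. *)
Lemma asymptotically_matched_iter (C : R) q e x :
  (forall y z, mdist y z <= C) -> 0 < e ->
  asymptotically_matched e x (iter q T x).
Proof.
move=> TC; elim: q e => [|q IH] e e0.
  near=> n; apply: (@matched_le _ _ _ _ _ _ _ ((n.+1 - 1)%:R * 0)).
    by rewrite mulr0 mulr_ge0// ltW.
  by apply: matched_bound => [|k _]; rewrite ?leqnn // mdistxx.
have e20 : 0 < e / 2 by rewrite divr_gt0.
rewrite (splitr e); apply: asymptotically_matched_trans (IH _ e20) _.
near=> n; apply: (@matched_le _ _ _ _ _ _ _ C); last first.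
  apply: matched_le (matched_succ (u := orb (iter q T x)) _ _) => //.
    by rewrite ltnS leqnn andbT; near: n; exact: nbhs_infty_gt.
  by move=> k; rewrite [RHS]iterSr.
rewrite -ler_pdivrMl//; near: n; exact: nbhs_infty_ger.
Unshelve. all: by end_near. Qed.

(** Cut off one block after another: each costs at most [e] per unit of length, and the remainder,
    of length at most [L], costs at most [C * L]. *)
Lemma matched_long (C e : R) (L : nat) :
  (forall y z, mdist y z <= C) -> 0 <= e ->
  (forall x y, exists2 l, (0 < l <= L)%N &
     matched l.+1 (orb x) (orb y) 1 l.+1 (e * l%:R)) ->
  forall t a n x y, (a.+1 + t <= n)%N ->
    matched n (orb x) (orb y) a.+1 (a.+1 + t) (e * t%:R + C * L%:R).
Proof.
move=> TC e0 blocks t; have [N] := ubnP t.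
elim: N t => // N IH t tN a n x y atn.
have C0 : 0 <= C by have := TC x x; rewrite mdistxx.
have [tL|Lt] := leqP t L.
  have := @matched_bound _ _ n (orb x) (orb y) a.+1 (a.+1 + t) C.
  rewrite addKn leq_addr => /(_ atn (fun _ _ => TC _ _)); apply: matched_le.
  by rewrite mulrC -[leLHS]add0r lerD ?mulr_ge0// ler_wpM2l// ler_nat.
(* Blocks are given from time 1 on, so the one starting at time [a.+1] is a block of the points
   reached at time [a]. *)
have [l /andP[l0 lL] lxy] := blocks (iter a T x) (iter a T y).
have -> : e * t%:R + C * L%:R = e * l%:R + (e * (t - l)%:R + C * L%:R).
  by rewrite natrB; [ring | lia].
apply: (@matched_cat _ _ _ _ _ _ (l.+1 + a)).
- by lia.
- rewrite -add1n; apply: (@matched_shift _ _ l.+1) => //; first by lia.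
  have shiftE z : (fun k => iter (k + a) T z) = orb (iter a T z).
    by apply/funext => k; rewrite iterD.
  by rewrite !shiftE.
- have -> : (a.+1 + t = (l + a).+1 + (t - l))%N by lia.
  by rewrite addSn; apply: IH; lia.
Qed.

(* A window starting at 0 is not covered by [matched_long], hence the unmatched
   first term. *)
Lemma BFbar_le (C e : R) (L : nat) x y :
  (forall y z, mdist y z <= C) -> 0 < e ->
  (forall x y, exists2 l, (0 < l <= L)%N &
     matched l.+1 (orb x) (orb y) 1 l.+1 (e * l%:R)) ->
  (BFbar T x y <= (e + e)%:E)%E.
Proof.
move=> TC e0 blocks.
have C0 : 0 <= C by have := TC x x; rewrite mdistxx.
apply: lime_le; first exact: is_cvg_limsup_length.
near=> N; apply: ge_ereal_sup => _ [[m n] /= [mn Nmn] <-].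
have nm0 : (0 : R) < (n - m)%:R by rewrite ltr0n subn_gt0.
rewrite lee_fin.
apply: (@le_trans _ _ ((C + (e * (n - m.+1)%:R + C * L%:R)) / (n - m)%:R)).
  apply: orbit_matching_le => //; apply: (@matched_cat _ _ _ _ _ _ m.+1).
  - by lia.
  - rewrite -[C]mul1r -[X in X * C]/(1%:R) -(subSnn m).
    by apply: matched_bound => //; lia.
  - by rewrite -{2}(subnKC mn); apply: matched_long => //; [exact: ltW | lia].
rewrite ler_pdivrMr// mulrDl addrCA lerD//.
  by rewrite ler_pM2l// ler_nat; lia.
(* The constant costs of the first term and of the remainder are absorbed by the second [e] once
   windows have length at least [N]. *)
have CN : e^-1 * (C + C * L%:R) <= N%:R.
  by near: N; exact: nbhs_infty_ger.
by rewrite -ler_pdivrMl//; apply: (le_trans CN); rewrite ler_nat.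
Unshelve. all: by end_near. Qed.

Lemma Fbar_le_BFbar x y : (Fbar T x y <= BFbar T x y)%E.
Proof.
rewrite /Fbar limn_esup_lim; apply: lee_lim.
- exact: is_cvg_esups.
- exact: is_cvg_limsup_length.
(* For [N > 0], the windows {1, ..., n} with [N <= n] are among those in the supremum on the
   right. *)
- near=> N; apply: ereal_sup_le => _ [n /= Nn <-]; exists (1, n.+1)%N => //=.
  rewrite subn1; split=> //; rewrite ltnS; apply: leq_trans Nn.
  by near: N; exact: nbhs_infty_gt.
Unshelve. all: by end_near. Qed.

Lemma matched_blocks e : compact [set: X] -> continuous T -> 0 < e ->
  (forall e' x y, 0 < e' -> asymptotically_matched e' x y) ->
  exists L : nat, forall x y, exists2 l, (0 < l <= L)%N &
     matched l.+1 (orb x) (orb y) 1 l.+1 (e * l%:R).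
Proof.
move=> Xcpt Tcont e0 all_matched.
have iter_cont k : continuous (iter k T).
  elim: k => [|k IH] x; first exact: cvg_id.
  exact: (continuous_comp (IH x) (Tcont _)).
have e30 : 0 < e / 3 by rewrite divr_gt0.
have /compact_near_coveringP := compact_setX Xcpt Xcpt.
move=> /(_ _ \oo (fun (L : nat) (p : X * X) =>
    exists2 l, (0 < l <= L)%N &
    matched l.+1 (orb p.1) (orb p.2) 1 l.+1 (e * l%:R))).
case=> [[x y] _|L _ LP]; last first.
  by exists L => x y; exact: (LP L (leqnn L) (x, y)).
(* A third of [e] is spent on this pair; the other two are kept for moving each of its points. *)
have [l [l0 lxy]] : exists l, (0 < l)%N /\
    matched l.+1 (orb x) (orb y) 1 l.+1 (e / 3 * l%:R).
  have /filter_ex[l] : \forall l \near \oo, (0 < l)%N /\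
    matched l.+1 (orb x) (orb y) 1 l.+1 (e / 3 * l%:R).
    near=> l; split; near: l; first exact: nbhs_infty_gt.
    exact: all_matched.
  by exists l.
(* Closeness at the finitely many times up to [l] is a neighbourhood condition and makes the
   identity matching cheap. *)
pose close z := [set z' | forall k : 'I_l.+1,
  mdist (iter k T z) (iter k T z') < e / 3].
have near_close z : nbhs z (close z).
  apply: filter_forall => k.
  exact: (metricType_numDomainType.cvgr_dist_lt (iter_cont k z)).
have close_matched z z' : close z z' ->
    matched l.+1 (orb z) (orb z') 1 l.+1 (e / 3 * l%:R).
  move=> zz'; have -> : e / 3 * l%:R = (l.+1 - 1)%:R * (e / 3).
    by rewrite subn1 mulrC.
  apply: matched_bound => [|k /andP[_ kl]]; first by rewrite leqnn.
  exact: ltW (zz' (Ordinal kl)).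
exists (close x `*` close y, [set L | (l <= L)%N]).
  by split; [exists (close x, close y) | exact: nbhs_infty_ge].
move=> [[x' y'] L] /= [[xx' yy'] lL]; exists l; first by rewrite l0.
have -> : e * l%:R = e / 3 * l%:R + e / 3 * l%:R + e / 3 * l%:R by field.
apply: matched_trans (close_matched _ _ yy').
exact: matched_trans (matched_sym (close_matched _ _ xx')) lxy.
Unshelve. all: by end_near. Qed.

Lemma all_asymptotically_matched e x y :
  (exists C : R, forall y z, mdist y z <= C) ->
  topologically_transitive T -> weak_mean_equicontinuous T -> 0 < e ->
  asymptotically_matched e x y.
Proof.
move=> [C TC] Ttrans Tme e0; have e30 : 0 < e / 3 by rewrite divr_gt0.
have [dx dx0 xP] := Tme x _ e30; have [dy dy0 yP] := Tme y _ e30.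
have ball_in z d : 0 < d -> (ball z d)° !=set0.
  by move=> d0; exists z; apply: nbhsx_ballx.
(* Transitivity asks for open sets, hence the interiors of the balls. *)
have [n [z /= [/interior_subset xz /interior_subset yz]]] :=
  Ttrans _ _ (@open_interior _ _) (@open_interior _ _)
    (ball_in x _ dx0) (ball_in y _ dy0).
move: xz yz; rewrite !ballEmdist /= => xz yz.
have -> : e = e / 3 + e / 3 + e / 3 by field.
(* Chain from [x] to [z] to [iter n T z] to [y], a third of [e] for each link. *)
apply: (@asymptotically_matched_trans _ _ _ (iter n T z)); last first.
  exact/asymptotically_matched_sym/Fbar_lt_asymptotically_matched/yP.
apply: (@asymptotically_matched_trans _ _ _ z).
  exact/Fbar_lt_asymptotically_matched/xP.
exact: asymptotically_matched_iter TC e30.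
Qed.

End orbits.

Theorem theorem6p10 (R : realType) (X : metricType R) (T : X -> X)
    (X_compact : compact [set: X]) (T_continuous : continuous T)
    (T_transitive : topologically_transitive T) :
  weak_Banach_mean_equicontinuous T <-> weak_mean_equicontinuous T.
Proof.
split=> Tme x e e0.
  have [d d0 xd] := Tme x e e0; exists d => // y /xd.
  exact: le_lt_trans (Fbar_le_BFbar _ _ _).
have e30 : 0 < e / 3 by rewrite divr_gt0.
have TC := compact_mdist_bounded X_compact.
have all_matched e' y z : 0 < e' -> asymptotically_matched T e' y z.
  exact: all_asymptotically_matched.
have [L blocks] := matched_blocks X_compact T_continuous e30 all_matched.
(* The bound holds for all pairs of points, so the radius 1 is arbitrary. *)
have [C XC] := TC; exists 1 => // y _.
by apply: le_lt_trans (BFbar_le _ _ XC e30 blocks) _; rewrite lte_fin; lra.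
Qed.
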